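(* Let $k$ and $m$ be positive integers, let $T$ be a tree of order $m$, and let $G$ be a $k$-edge-connected graph with $\delta(G)>4(k+m)^2$. Then $G$ contains a subtree $T'$ isomorphic to $T$ such that $G-V(T')$ is $k$-edge-connected.
   Context: All graphs are finite, undirected, without loops or multiple edges. $\delta(G)$ is the minimum degree of $G$. For $S\subseteq V(G)$, $G-S$ denotes the subgraph of $G$ induced by $V(G)\setminus S$. The edge-connectivity $\kappa'(G)$ is the minimum size of an edge set $U\subseteq E(G)$ such that $G-U$ is disconnected; a graph is $k$-edge-connected if $\kappa'(G)\geq k$. By convention a trivial (one-vertex) graph is $1$-edge-connected but not $k$-edge-connected for any $k>1$. *)

(* Defs.v *)
From mathcomp Require Import all_boot.
Set Implicit Arguments. Unset Strict Implicit. Unset Printing Implicit Defensive.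

Definition simple_graph (V : finType) (e : rel V) : Prop :=
  symmetric e /\ irreflexive e.

Definition induced_edges (V : finType) (e : rel V) (S : {set V}) : {set {set V}} :=
  [set [set x; y] | x in S, y in S & e x y].

Definition del_rel (V : finType) (e : rel V) (S : {set V}) (U : {set {set V}}) : rel V :=
  fun x y => [&& x \in S, y \in S, e x y & [set x; y] \notin U].

Definition connected_del (V : finType) (e : rel V) (S : {set V}) (U : {set {set V}}) : Prop :=
  forall x y, x \in S -> y \in S -> connect (del_rel e S U) x y.

(* G[S] is k-edge-connected: kappa'(G[S]) >= k, i.e. deleting fewer than k edges
   never disconnects it; conventions: the one-vertex graph is 1- but not
   k-edge-connected for k > 1; the empty graph is not k-edge-connected. *)
Definition k_edge_connected (V : finType) (e : rel V) (S : {set V}) (k : nat) : Prop :=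
  [/\ 0 < #|S|, (1 < k -> 1 < #|S|) &
      forall U : {set {set V}}, U \subset induced_edges e S -> #|U| < k ->
        connected_del e S U].

Definition is_tree (W : finType) (t : rel W) : Prop :=
  [/\ simple_graph t,
      (forall x y, connect t x y) &
      (forall c : seq W, 3 <= size c -> ~~ ucycleb t c)].

Definition min_degree_gt (V : finType) (e : rel V) (d : nat) : Prop :=
  forall v : V, d < #|[set w | e v w]|.

(* Main.v *)
(* Cap the boundary of a vertex set at C = k + m per outside vertex:
   w(F) is the sum over v outside F of min(C, |N(v) :&: F|), and let F be a
   minimal nonempty set with w(F) <= M = 2(Cm + k).  All but at most M vertices
   of F have no neighbour among the outside vertices of low degree into F, and
   they induce a graph of minimum degree at least m, so the tree embeds
   greedily there, on a set T.  Suppose fewer than k edges join the parts X and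
   Y of V - T.  If X misses F, then either X contains a vertex with at least
   C - m >= k neighbours in Y, or no edge joins X to T and the cut is already
   one of G.  If X and Y both meet F, then
   w(X :&: F) + w(Y :&: F) <= 2Cm + w(F) + 2e(X, Y) < 2(M + 1), so one of these
   proper subsets of F contradicts minimality. *)
Require Import Defs.
From mathcomp Require Import all_boot.
From mathcomp Require Import zify.

Set Implicit Arguments. Unset Strict Implicit. Unset Printing Implicit Defensive.

(** * Degrees into a set and edge counts between two sets *)

Definition deg_in (V : finType) (e : rel V) (A : {set V}) (v : V) : nat :=
  #|[set w in A | e v w]|.

(** This counts ordered pairs, so it is the number of edges between [A] and [B] when they are
    disjoint. *)
Definition cut (V : finType) (e : rel V) (A B : {set V}) : nat :=
  \sum_(a in A) deg_in e B a.

Definition capped_boundary (V : finType) (e : rel V) (C : nat) (F : {set V}) : nat :=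
  \sum_(v in ~: F) minn C (deg_in e F v).

Lemma deg_in_sum (V : finType) (e : rel V) (A : {set V}) (v : V) :
  deg_in e A v = \sum_(w in A) e v w.
Proof.
rewrite /deg_in -sum1_card big_mkcond [RHS]big_mkcond /=.
by apply: eq_bigr => w _; rewrite inE; case: (w \in A); case: (e v w).
Qed.

Lemma deg_inS (V : finType) (e : rel V) (A B : {set V}) (v : V) :
  A \subset B -> deg_in e A v <= deg_in e B v.
Proof.
move=> /subsetP sAB; apply/subset_leq_card/subsetP => w.
by rewrite !inE => /andP[/sAB -> ->].
Qed.

Lemma deg_inU (V : finType) (e : rel V) (A B : {set V}) (v : V) :
  deg_in e (A :|: B) v <= deg_in e A v + deg_in e B v.
Proof.
apply: leq_trans (leq_card_setU _ _); apply/subset_leq_card/subsetP => w.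
by rewrite !inE => /andP[/orP[] -> ->]; rewrite ?orbT.
Qed.

Lemma deg_in_le_card (V : finType) (e : rel V) (A : {set V}) (v : V) :
  deg_in e A v <= #|A|.
Proof. by apply/subset_leq_card/subsetP => w; rewrite inE => /andP[]. Qed.

Lemma cutC (V : finType) (e : rel V) (A B : {set V}) :
  symmetric e -> cut e A B = cut e B A.
Proof.
move=> e_sym; rewrite /cut.
under eq_bigr do rewrite deg_in_sum.
rewrite exchange_big; apply: eq_bigr => b _; rewrite deg_in_sum.
by apply: eq_bigr => a _; rewrite e_sym.
Qed.

Lemma deg_in_le_cut (V : finType) (e : rel V) (A B : {set V}) (a : V) :
  a \in A -> deg_in e B a <= cut e A B.
Proof. by move=> aA; rewrite /cut (bigD1 a) //= leq_addr. Qed.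

Lemma cut_card (V : finType) (e : rel V) (A B : {set V}) :
  cut e A B = #|[set p : V * V | [&& p.1 \in A, p.2 \in B & e p.1 p.2]]|.
Proof.
rewrite /cut; under eq_bigr do rewrite deg_in_sum.
rewrite pair_big -sum1_card big_mkcond [RHS]big_mkcond /=.
apply: eq_bigr => p _; rewrite inE.
by case: (p.1 \in A); case: (p.2 \in B); case: (e _ _).
Qed.

(** Disjointness makes [(a, b) |-> {a, b}] injective on the crossing pairs. *)
Lemma cut_le_edges (V : finType) (e : rel V) (A B : {set V}) (U : {set {set V}}) :
  [disjoint A & B] ->
  (forall a b, a \in A -> b \in B -> e a b -> [set a; b] \in U) ->
  cut e A B <= #|U|.
Proof.
move=> dAB sU; rewrite cut_card.
have inj : {in [set p : V * V | [&& p.1 \in A, p.2 \in B & e p.1 p.2]] &,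
            injective (fun p => [set p.1; p.2])}.
  move=> [a b] [c d]; rewrite !inE /= => /and3P[aA bB _] /and3P[cA dB _] E.
  have : b \in [set c; d] by rewrite -E set22.
  have : a \in [set c; d] by rewrite -E set21.
  rewrite !inE => /orP[] /eqP Ea /orP[] /eqP Eb; last 2 first.
  - by rewrite Ea (disjointFl dAB dB) in aA.
  - by rewrite Ea (disjointFl dAB dB) in aA.
  - by rewrite Eb (disjointFr dAB cA) in bB.
  - by rewrite Ea Eb.
rewrite -(card_in_imset inj); apply/subset_leq_card/subsetP => s.
by case/imsetP=> -[a b]; rewrite inE /= => /and3P[aA bB eab] ->; apply: sU.
Qed.

(** * Edge-connectivity expressed through cuts *)

Lemma connect_exit (V : finType) (e : rel V) (A : {set V}) (x y : V) :
  x \in A -> y \notin A -> connect e x y ->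
  exists a b, [/\ a \in A, b \notin A & e a b].
Proof.
move=> xA yA /connectP[p]; elim: p x xA => [x xA _ E|z p IH x xA /= /andP[xz zp]].
  by rewrite E xA in yA.
by have [zA|zA] := boolP (z \in A); [apply: IH zp | exists x, z].
Qed.

Lemma k_edge_connected_cut (V : finType) (e : rel V) (k : nat) (X : {set V}) :
  k_edge_connected e [set: V] k -> X != set0 -> ~: X != set0 ->
  k <= cut e X (~: X).
Proof.
move=> [_ _ conn] /set0Pn[x xX] /set0Pn[y]; rewrite inE => yX.
rewrite leqNgt; apply/negP => lt_cut.
pose D := [set p : V * V | [&& p.1 \in X, p.2 \in ~: X & e p.1 p.2]].
pose U := [set [set p.1; p.2] | p in D].
have sU : U \subset induced_edges e [set: V].
  apply/subsetP => s /imsetP[[a b]]; rewrite inE /= => /and3P[_ _ eab] ->.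
  by apply/imset2P; exists a b; rewrite ?inE.
have ltU : #|U| < k.
  by apply: leq_ltn_trans lt_cut; rewrite cut_card; apply: leq_imset_card.
have := connect_exit xX yX (conn U sU ltU x y (in_setT _) (in_setT _)).
case=> a [b [aX bX /and4P[_ _ eab /negP[]]]].
by apply/imsetP; exists (a, b); rewrite ?inE //= aX bX.
Qed.

(** If deleting [U] separates [x] from [y], every edge leaving the component of [x] lies in [U], so
    [U] is at least as large as that cut. *)
Lemma cuts_k_edge_connected (V : finType) (e : rel V) (S : {set V}) (k : nat) :
  0 < #|S| -> (1 < k -> 1 < #|S|) ->
  (forall X : {set V}, X \subset S -> X != set0 -> S :\: X != set0 ->
     k <= cut e X (S :\: X)) ->
  k_edge_connected e S k.
Proof.
move=> S0 S1 cuts; split=> // U _ ltU x y xS yS; apply: contraLR ltU => nxy.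
rewrite -leqNgt; pose X := [set z in S | connect (del_rel e S U) x z].
have XS : X \subset S by apply/subsetP => z; rewrite inE => /andP[].
apply: leq_trans (cuts X XS _ _) _.
- by apply/set0Pn; exists x; rewrite inE xS connect0.
- by apply/set0Pn; exists y; rewrite !inE yS nxy.
apply: cut_le_edges => [|a b]; first by rewrite disjoint_sym disjoints_subset subsetDr.
rewrite !inE => /andP[aS xa] /andP[/nandP[nbS|nxb] bS] eab; first by rewrite bS in nbS.
apply: contraR nxb => abU; apply: connect_trans xa (connect1 _).
by rewrite /del_rel aS bS eab.
Qed.

(** * Greedy embedding of a tree *)

Definition restrict (V : finType) (e : rel V) (A : {set V}) : rel V :=
  fun x y => [&& x \in A, y \in A & e x y].

Lemma restrictS (V : finType) (e : rel V) (A B : {set V}) (x y : V) :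
  A \subset B -> connect (restrict e A) x y -> connect (restrict e B) x y.
Proof.
move=> /subsetP sAB; apply: connect_sub => u v /and3P[/sAB uB /sAB vB uv].
by apply: connect1; apply/and3P.
Qed.

(* A second neighbour of [b] in the connected set [A] would close a cycle. *)
Lemma tree_unique_neighbor (W : finType) (t : rel W) (A : {set W}) (a a' b : W) :
  is_tree t -> b \notin A -> t a b -> t a' b ->
  connect (restrict t A) a a' -> a \in A -> a = a'.
Proof.
move=> [[t_sym _] _ acyc] bA tab ta'b /connectP[p0 /shortenP[p path_p uniq_p _] E] aA.
rewrite {a'}E in ta'b *.
case: p path_p uniq_p ta'b => [//|c p] path_p uniq_p ta'b.
have sA : all [in A] (a :: c :: p).
  suff sAp : all [in A] (c :: p) by apply/andP.
  elim: (c :: p) (a) path_p => //= v s IH u /andP[/and3P[_ vA _] /IH ->].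
  by rewrite vA.
have /negP[] := acyc [:: b, a, c & p] isT.
apply/andP; split; last first.
  by rewrite cons_uniq uniq_p andbT; apply: contra bA => /(allP sA).
rewrite /= rcons_path t_sym tab /=.
have sub : subrel (restrict t A) t by move=> u v /and3P[].
have /= /andP[-> ->] := sub_path sub path_p.
by move: ta'b => /= ->.
Qed.

Lemma embed_tree (W : finType) (t : rel W) (V : finType) (e : rel V) (P : {set V}) :
  0 < #|W| -> is_tree t -> symmetric e -> P != set0 ->
  (forall v, v \in P -> #|W| <= deg_in e P v) ->
  exists f : W -> V,
    [/\ injective f, (forall a b, t a b -> e (f a) (f b)) & forall a, f a \in P].
Proof.
move=> /card_gt0P[r _] tree_t e_sym /set0Pn[v0 v0P] degP.
have [[t_sym t_irr] t_conn _] := tree_t.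
(* Grow a connected vertex set [A] around a root [r]. The map is total, and its values outside [A]
   only have to stay in [P]. *)
have main j : j < #|W| -> exists (A : {set W}) (f : W -> V),
    [/\ #|A| = j.+1, r \in A, (forall a, a \in A -> connect (restrict t A) r a),
        {in A &, injective f} &
        (forall a b, a \in A -> b \in A -> t a b -> e (f a) (f b)) /\
        forall a, f a \in P].
  elim: j => [_|j IH ltj].
    exists [set r], (fun=> v0); rewrite cards1 set11; split=> //.
    - by move=> a /set1P ->.
    - by move=> a b /set1P -> /set1P ->.
    - by split=> // a b /set1P -> /set1P ->; rewrite t_irr.
  have [A [f [cardA rA connA injf [homf fP]]]] := IH (ltnW ltj).
  have /set0Pn[y] : ~: A != set0 by rewrite -card_gt0 cardsCs setCK; lia.
  rewrite inE => yA; have [a [b [aA bA tab]]] := connect_exit rA yA (t_conn r y).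
  have sym_restr : connect_sym (restrict t A).
    by apply: sym_connect_sym => u v; rewrite /restrict t_sym andbCA.
  have uniq_nb a' : a' \in A -> t a' b -> a' = a.
    move=> a'A ta'b; apply/esym; apply: (tree_unique_neighbor tree_t bA tab ta'b) => //.
    by apply: (connect_trans _ (connA _ a'A)); rewrite sym_restr; apply: connA.
  (* [f a] has at least [#|W|] neighbours in [P], and fewer than [#|W|] vertices are used. As [a] is
     the only neighbour of [b] in [A], any fresh neighbour of [f a] can serve as the image of
     [b]. *)
  have /set0Pn[v] : [set w in P | e (f a) w] :\: f @: A != set0.
    rewrite setD_eq0; apply/negP => /subset_leq_card.
    by have := degP _ (fP a); have := leq_imset_card f A; rewrite /deg_in; lia.
  rewrite !inE => /and3P[vfA vP eav].
  have bneq a' : a' \in A -> (a' == b) = false.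
    by move=> a'A; apply: contraNF bA => /eqP <-.
  have vneq a' : a' \in A -> f a' <> v.
    by move=> a'A E; rewrite -E imset_f in vfA.
  exists (b |: A), (fun x => if x == b then v else f x).
  split.
  - by rewrite cardsU1 bA cardA.
  - by rewrite !inE rA orbT.
  - have cA c : c \in A -> connect (restrict t (b |: A)) r c.
      by move=> /connA; apply: restrictS; apply: subsetU1.
    move=> c /setU1P[->|/cA //]; apply: connect_trans (cA a aA) (connect1 _).
    by rewrite /restrict !inE eqxx aA tab orbT.
  - move=> c d /setU1P[->|cA] /setU1P[->|dA]; rewrite ?eqxx ?bneq // => E.
    + by case: (vneq d dA).
    + by case: (vneq c cA).
    + exact: injf.
  - split=> [c d|c]; last by case: eqP.
    move=> /setU1P[->|cA] /setU1P[->|dA]; rewrite ?eqxx ?bneq ?t_irr //.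
    + by rewrite t_sym => /uniq_nb -> //; rewrite e_sym.
    + by move=> /uniq_nb ->.
    + exact: homf.
have W0 : 0 < #|W| by apply/card_gt0P; exists r.
have [|A [f [cardA _ _ injf [homf fP]]]] := main #|W|.-1; first by rewrite prednK.
have AT : A = [set: W].
  by apply/eqP; rewrite eqEcard subsetT cardsT cardA prednK /=.
by exists f; split=> // [a b|a b]; [apply: injf | apply: homf]; rewrite AT inE.
Qed.

(** * The capped boundary *)

Lemma capped_boundaryE (V : finType) (e : rel V) (C : nat) (F : {set V}) :
  capped_boundary e C F =
    #|[set v in ~: F | C <= deg_in e F v]| * C
    + cut e [set v in ~: F | deg_in e F v < C] F.
Proof.
rewrite /capped_boundary (bigID (fun v => C <= deg_in e F v)) /= -sum_nat_const /cut.
congr (_ + _); apply: eq_big => v; rewrite ?inE ?ltnNge // => /andP[_].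
  by move/minn_idPl.
by rewrite -ltnNge => /ltnW/minn_idPr.
Qed.

(* Posimodularity, up to the vertices outside [X] and [Y] and the edges between them. *)
Lemma capped_boundary_cross (V : finType) (e : rel V) (C : nat) (F X Y : {set V}) :
  symmetric e -> [disjoint X & Y] -> ~: (X :|: Y) \subset F ->
  capped_boundary e C (X :&: F) + capped_boundary e C (Y :&: F) <=
    #|~: (X :|: Y)| * (C + C) + capped_boundary e C F + (cut e X Y + cut e X Y).
Proof.
move=> e_sym dXY /subsetP sF.
(* One copy of the cut is summed over [Y], so the bound can be checked vertex by vertex: the degree
   of [v] into the opposite part absorbs the excess, and a vertex in neither part lies in [F] and
   costs at most [2C]. *)
rewrite {2}(cutC _ _ e_sym) -sum_nat_const /cut /capped_boundary.
rewrite big_mkcond [X in _ + X <= _]big_mkcond /= -big_split /=.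
rewrite [X in _ <= X + _ + _]big_mkcond [X in _ <= _ + X + _]big_mkcond /=.
rewrite [X in _ <= _ + (X + _)]big_mkcond [X in _ <= _ + (_ + X)]big_mkcond /=.
rewrite -!big_split /=; apply: leq_sum => v _.
have lX : deg_in e (X :&: F) v <= deg_in e X v by apply/deg_inS/subsetIl.
have lY : deg_in e (Y :&: F) v <= deg_in e Y v by apply/deg_inS/subsetIl.
have lXF : deg_in e (X :&: F) v <= deg_in e F v by apply/deg_inS/subsetIr.
have lYF : deg_in e (Y :&: F) v <= deg_in e F v by apply/deg_inS/subsetIr.
move: (sF v); rewrite !inE.
have [vX|vX] := boolP (v \in X); first rewrite (disjointFr dXY vX) /=.
  by case: (v \in F) => /= _; lia.
by case: (v \in Y) => /=; case: (v \in F) => /= H; try (by have := H isT); lia.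
Qed.

(** * Connectivity after removing the tree *)

Lemma k_edge_connected_setC (V : finType) (e : rel V) (k m M C : nat) (F T : {set V}) :
  symmetric e -> k_edge_connected e [set: V] k ->
  k + m <= C -> 2 * (C * m + k) <= M + 2 ->
  capped_boundary e C F <= M ->
  (forall Z : {set V}, Z != set0 -> Z \proper F -> M < capped_boundary e C Z) ->
  T \subset F -> T != set0 -> #|T| <= m ->
  (forall v w, v \in T -> w \notin F -> e v w -> C <= deg_in e F w) ->
  0 < #|~: T| -> (1 < k -> 1 < #|~: T|) ->
  k_edge_connected e (~: T) k.
Proof.
move=> e_sym conn leC leM leF minF sTF T0 cardT nbT c0 c1.
have cut_side X Y : X :|: Y = ~: T -> [disjoint X & Y] -> X != set0 -> X :&: F = set0 ->
    k <= cut e X Y.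
  move=> XY dXY X0 XF0.
  have nF v : v \in X -> v \notin F.
    by move=> vX; apply/negP => vF; have := in_set0 v; rewrite -XF0 inE vX vF.
  have FY : F \subset T :|: Y.
    apply/subsetP => v vF; rewrite inE; have [//|vT] := boolP (v \in T).
    have : v \in X :|: Y by rewrite XY inE.
    by rewrite inE => /orP[/nF|//]; rewrite vF.
  have [/existsP[s /andP[sX sC]]|noS] := boolP [exists s in X, C <= deg_in e F s].
    apply: leq_trans (deg_in_le_cut e Y sX).
    have := deg_inU e T Y s; have := deg_inS e s FY; have := deg_in_le_card e T s.
    by lia.
  have XC : ~: X = T :|: Y.
    apply/setP => v; move/setP/(_ v): (XY); rewrite !inE.
    have [vX|vX] /= := boolP (v \in X); last by move=> ->; case: (v \in T).
    by rewrite (disjointFr dXY vX); case: (v \in T).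
  have le := k_edge_connected_cut conn X0.
  have X'0 : ~: X != set0.
    by case/set0Pn: T0 => v vT; apply/set0Pn; exists v; rewrite XC inE vT.
  apply: leq_trans (le X'0) _; rewrite XC; apply: leq_sum => v vX.
  apply: leq_trans (deg_inU _ _ _ _) _.
  (* By [nbT], a neighbour of [T] in [X] would have [C] neighbours in [F], against [noS]. *)
  suff -> : deg_in e T v = 0 by [].
  apply/eqP; rewrite cards_eq0; apply/eqP/setP => w; rewrite !inE.
  apply/negP => /andP[wT evw].
  case/negP: noS; apply/existsP; exists v; rewrite vX.
  by apply: (nbT w) => //; [apply: nF | rewrite e_sym].
apply: cuts_k_edge_connected => // X sX X0 Y0; set Y := _ :\: X in Y0 *.
have dXY : [disjoint X & Y] by rewrite disjoint_sym disjoints_subset subsetDr.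
have XY : X :|: Y = ~: T by rewrite /Y setDE setUIr setUCr setIT; apply/setUidPr.
have [XF0|XF0] := eqVneq (X :&: F) set0; first exact: cut_side.
have [YF0|YF0] := eqVneq (Y :&: F) set0.
  by rewrite cutC //; apply: cut_side => //; rewrite ?[Y :|: X]setUC // disjoint_sym.
(* Properness comes from the nonempty [T], which lies in [F] and misses [Z]. *)
have prop (Z : {set V}) : Z \subset ~: T -> Z :&: F \proper F.
  move=> /subsetP sZ; rewrite properEneq subsetIr andbT.
  case/set0Pn: T0 => v vT; apply: contraTneq vT => E.
  have [|vF] := boolP (v \in F); last by apply: contra vF; apply: (subsetP sTF).
  by rewrite -{1}E inE => /andP[/sZ]; rewrite inE.
have mX := minF _ XF0 (prop X sX).
have mY := minF _ YF0 (prop Y (subsetDl _ _)).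
have TE : ~: (X :|: Y) = T by rewrite XY setCK.
have := capped_boundary_cross C e_sym dXY; rewrite TE => /(_ _ sTF) cross.
have : #|T| * C <= m * C by rewrite leq_mul2r cardT orbT.
(* [2(M + 1) <= 2Cm + M + 2 cut] and [2(Cm + k) <= M + 2] give [k <= cut]. *)
by nia.
Qed.

Theorem theorem3p3 (k m : nat) (W : finType) (t : rel W) (V : finType) (e : rel V) :
  0 < k -> 0 < m ->
  is_tree t -> #|W| = m ->
  simple_graph e ->
  k_edge_connected e [set: V] k ->
  min_degree_gt e (4 * (k + m) ^ 2) ->
  exists f : W -> V,
    [/\ injective f,
        (forall a b, t a b -> e (f a) (f b)) &
        k_edge_connected e (~: (f @: [set: W])) k].
Proof.
move=> k0 m0 tree_t cardW [e_sym e_irr] conn degV.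
have degT v : 4 * (k + m) ^ 2 < deg_in e [set: V] v.
  by apply: leq_trans (degV v) _; apply/subset_leq_card/subsetP => w; rewrite !inE.
pose C := k + m; pose M := 2 * (C * m + k).
have leM : 2 * M <= 4 * (k + m) ^ 2 by rewrite /M /C; nia.
have lem : m <= M by rewrite /M /C; nia.
have [V0 _ _] := conn.
(* The whole vertex set has nothing outside it, hence boundary 0, so a minimal [F] exists. *)
have [|F /minsetP[/andP[F0 leF] minF] _] :=
    @minset_exists V (fun F => (F != set0) && (capped_boundary e C F <= M)) [set: V].
  by rewrite -card_gt0 V0 /capped_boundary setCT big_set0.
have minF' (Z : {set V}) : Z != set0 -> Z \proper F -> M < capped_boundary e C Z.
  move=> Z0; rewrite properEneq ltnNge => /andP[/eqP neq sZF]; apply/negP => leZ.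
  by case: neq; apply: minF => //; rewrite Z0.
pose S := [set v in ~: F | C <= deg_in e F v].
pose Q := [set v in ~: F | deg_in e F v < C].
(* The tree is kept out of [B], so that its neighbours outside [F] all lie in [S]. *)
pose B := [set v in F | 0 < deg_in e Q v].
have leSQ : #|S| + cut e F Q <= M.
  apply: leq_trans leF; rewrite capped_boundaryE -/S -/Q (cutC _ _ e_sym).
  by rewrite leq_add2r leq_pmulr // addn_gt0 k0.
have leB : #|B| <= cut e F Q.
  rewrite -sum1_card /cut [leqRHS](big_setID B) /=.
  have -> : F :&: B = B by apply/setIidPr/subsetP => v; rewrite inE => /andP[].
  by apply: leq_trans (leq_addr _ _); apply: leq_sum => v; rewrite inE => /andP[].
have degF v : deg_in e [set: V] v <= deg_in e F v + #|S| + deg_in e Q v.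
  have /(deg_inS e v) : [set: V] \subset F :|: S :|: Q.
    apply/subsetP => w _; rewrite !inE leqNgt.
    by case: (w \in F); case: (_ < C).
  have := deg_inU e (F :|: S) Q v; have := deg_inU e F S v.
  by have := deg_in_le_card e S v; lia.
(* If [F] were inside [B], then [#|F| <= M], and a vertex of [F] would have degree at most
   [#|F| + #|S| + cut e F Q <= 2M]. *)
have P0 : F :\: B != set0.
  apply: contraNneq (F0) => /eqP; rewrite setD_eq0 => /subset_leq_card leFB.
  apply/eqP/setP => v; rewrite inE; apply/negP => vF.
  have := degT v; have := degF v; have := deg_in_le_cut e Q vF.
  by have := deg_in_le_card e F v; lia.
have [||f [inj_f hom_f fP]] := embed_tree _ tree_t e_sym P0.
- by rewrite cardW.
(* Of more than [2M] neighbours, at most [#|S| + #|B| <= M] lie outside [F :\: B], which leaves more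
   than [M >= m]. *)
- move=> v; rewrite cardW => vP; have := degT v; have := degF v.
  have -> : deg_in e Q v = 0.
    by move: vP; rewrite !inE; case: (v \in F); rewrite ?andbF //= andbT -eqn0Ngt => /eqP.
  have := deg_inU e (F :\: B) B v; have := deg_in_le_card e B v.
  have /(deg_inS e v) : F \subset F :\: B :|: B by rewrite setUC -subDset.
  by lia.
have cardT : #|f @: [set: W]| = m by rewrite card_imset // cardsT.
have [w0 _] : exists w : W, w \in predT by apply/card_gt0P; rewrite cardW.
have cardTC : 1 < #|~: (f @: [set: W])|.
  have := degT (f w0); have := deg_in_le_card e [set: V] (f w0).
  by rewrite cardsT cardsCs setCK cardT; nia.
exists f; split=> //.
apply: (k_edge_connected_setC (m := m) (M := M) (C := C) (F := F)) => //.
- by rewrite /M leq_addr.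
- by apply/subsetP => _ /imsetP[w _ ->]; have := fP w; rewrite inE => /andP[].
- by apply/set0Pn; exists (f w0); apply: imset_f.
- by rewrite cardT.
- move=> _ v /imsetP[w _ ->] vF efv; rewrite leqNgt; apply/negP => ltC.
  have := fP w; rewrite !inE => /andP[/nandP[nfF|nB] fF]; first by rewrite fF in nfF.
  by case/negP: nB; rewrite card_gt0; apply/set0Pn; exists v; rewrite !inE vF ltC.
- exact: ltnW.
Qed.
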